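(* Every Lindelöf Hausdorff space is $\chi$-Lindelöf.
   Context: All spaces are assumed to be Hausdorff. A space is Lindelöf if every open cover has a countable subcover (no separation axiom beyond Hausdorff is assumed). The character $\chi(X)$ of a space $X$ is the smallest infinite cardinal $\kappa$ such that every point of $X$ has a local base of cardinality not exceeding $\kappa$. $[S]^{<\omega}$ denotes the collection of all finite subsets of $S$, and $\overline{B}$ denotes the closure of $B$ in $X$. ''Countable'' means of cardinality at most $\omega$. For a cardinal $\kappa$, a $\kappa$-net in $X$ is an indexed family $\xi=\{x_F:F\in[\kappa]^{<\omega}\}$ of points of $X$ (indexed by the finite subsets of $\kappa$; repetitions allowed). We write $\xi\subseteq A$ if $x_F\in A$ for all $F$. Let $A\subseteq X$ and let $\xi=\{x_F:F\in[\kappa]^{<\omega}\}\subseteq A$ be a $\kappa$-net. A point $x\in A$ is a $\theta$-cluster point of $\xi$ relative to $A$ if, for every open set $U$ of $X$ with $x\in U$ and every $\alpha<\kappa$, there exists $F\in[\kappa]^{<\omega}$ such that $\alpha\in F$ and $x_F\in\overline{U\cap A}$. If $A=X$, we say that $x$ is a $\theta$-cluster point of $\xi$ (in $X$). A set $A\subseteq X$ is $\chi$-net-closed if for every $\chi(X)$-net $\xi=\{x_F:F\in[\chi(X)]^{<\omega}\}\subseteq A$: if $\xi$ has a $\theta$-cluster point in $X$, then $\xi$ has a $\theta$-cluster point in $A$ relative to $A$. A space $X$ is $\chi$-Lindelöf if for every $\chi$-net-closed set $A\subseteq X$ and every collection $\mathcal{U}=\bigcup\{\mathcal{U}_\alpha:\alpha<\chi(X)\}$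 of open sets in $X$ which covers $A$ (presented as a union of subcollections $\mathcal{U}_\alpha$), there are countable subcollections $\mathcal{V}_\alpha\subseteq\mathcal{U}_\alpha$ for each $\alpha<\chi(X)$ such that $A\subseteq\bigcup\{\overline{\bigcup\mathcal{V}_\alpha}:\alpha<\chi(X)\}$. *)

(* Defs.v *)
From HB Require Import structures.
From mathcomp Require Import all_boot all_order finmap.
From mathcomp Require Import boolp classical_sets functions cardinality.
From mathcomp Require Import topology_structure separation_axioms.

Set Implicit Arguments.
Unset Strict Implicit.
Unset Printing Implicit Defensive.

Local Open Scope classical_set_scope.
Local Open Scope card_scope.

Definition lindelof (T : topologicalType) : Prop :=
  forall U : set (set T), (forall O, U O -> open O) ->
    [set: T] `<=` \bigcup_(O in U) O ->
    exists V : set (set T),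
      [/\ V `<=` U, countable V & [set: T] `<=` \bigcup_(O in V) O].

Definition local_base (T : topologicalType) (x : T) (B : set (set T)) : Prop :=
  (forall O, B O -> open_nbhs x O) /\
  (forall U, open_nbhs x U -> exists2 O, B O & O `<=` U).

(** Cardinals are represented by types, compared through [#<=]. *)
Definition character_bound (T : topologicalType) (K : Type) : Prop :=
  infinite_set [set: K] /\
  forall x : T, exists2 B, local_base x B & B #<= [set: K].

Definition is_character (T : topologicalType) (K : Type) : Prop :=
  character_bound T K /\
  forall K' : Type, character_bound T K' -> [set: K] #<= [set: K'].

Lemma min_card (W : Type) (w0 : W) (G : set (set W)) : G !=set0 ->
  exists2 K, G K & forall K', G K' -> K #<= K'.
Proof.
move=> [G0 GG0].
pose P (F : set (set W -> W)) :=
  (forall f K, F f -> G K -> K (f K)) /\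
  (forall f g K, F f -> F g -> G K -> f K = g K -> f = g).
have [|F [[PF1 PF2] Fmax]] := @Zorn_bigcup _ P.
  move=> C CP Ctot; split.
    by move=> f K [A CA Af] GK; have [AP _] := CP _ CA; exact: AP f K Af GK.
  move=> f g K [A CA Af] [B CB Bg] GK.
  have [AB|BA] := Ctot _ _ CA CB.
    by have [_ BP] := CP _ CB; exact: BP (AB _ Af) Bg GK.
  by have [_ AP] := CP _ CA; exact: AP Af (BA _ Bg) GK.
have [[K GK KF]|noK] :=
    pselect (exists2 K, G K & K `<=` [set f K | f in F]).
  exists K => // K' GK'.
  have KleF : K #<= F.
    exact: card_le_trans (subset_card_le KF) (card_image_le _ _).
  apply: card_le_trans KleF _.
  have FI : set_inj F (fun f => f K').
    by move=> f g /set_mem Ff /set_mem Fg; exact: PF2.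
  rewrite -(card_le_eql (inj_card_eq FI)).
  by apply: subset_card_le => _ [f Ff <-]; exact: PF1 _ _ Ff GK'.
have /choice[f0 f0P] : forall K, exists w,
    G K -> K w /\ ~ [set f K | f in F] w.
  move=> K; have [GK|nGK] := pselect (G K); last by exists w0.
  have : ~ (K `<=` [set f K | f in F]) by move=> KF; apply: noK; exists K.
  by move=> /existsNP[w /not_implyP[Kw nw]]; exists w.
have nFf0 : ~ F f0.
  by move=> Ff0; have [_] := f0P _ GG0; apply; exists f0.
exfalso; apply: (Fmax (f0 |` F)).
  split; first by move=> f Ff; right.
  by move=> /(_ f0); apply: contra_not nFf0; apply; left.
split.
  move=> f K [->|Ff] GK; first exact: (f0P _ GK).1.
  exact: PF1 _ _ Ff GK.
move=> f g K [->|Ff] [->|Fg] GK // fg; last exact: PF2 fg.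
- by have [_] := f0P _ GK; case; exists g.
- by have [_] := f0P _ GK; case; exists f.
Qed.

Lemma character_bound_card (T : topologicalType) (K K' : Type) :
  [set: K] #<= [set: K'] -> character_bound T K -> character_bound T K'.
Proof.
move=> KK' [Kinf KB]; split.
  by apply: contra_not Kinf => K'fin; exact: card_le_finite KK' K'fin.
by move=> x; have [B Bx BK] := KB x; exists B => //; exact: card_le_trans KK'.
Qed.

(** [nat] ensures that the bound is infinite, and [set T] has room for a local
    base at each point, so some subset of [nat + set T] has cardinality
    [chi(T)]. *)
Lemma character_exists (T : topologicalType) :
  exists K : set (nat + set T), is_character T K.
Proof.
set W : Type := (nat + set T)%type.
have [|K Kb Kmin] :=
    @min_card W (inl 0) [set K : set W | character_bound T K].
  exists [set: W]; apply: (@character_bound_card T W).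
    by rewrite (card_le_eqr (card_setT _)).
  split=> [Wfin|x].
    apply: infinite_nat; apply: card_le_finite Wfin.
    rewrite -(card_le_eql (_ : (@inl nat (set T)) @` [set: nat] #= _)).
      exact: card_leT.
    by apply: inj_card_eq => ? ? _ _ [].
  exists (open_nbhs x); first by split=> // U xU; exists U.
  rewrite -(card_le_eql (_ : (@inr nat (set T)) @` open_nbhs x #= _)).
    exact: card_leT.
  by apply: inj_card_eq => ? ? _ _ [].
exists K; split=> // U TU; rewrite (card_le_eql (card_setT K)).
pose inW (A : set W) : set (W + U) := inl @` A.
have inlI A : inW A #= A by apply: inj_card_eq => ? ? _ _ [].
have inrI : range (@inr W U) #= [set: U] by apply: inj_card_eq => ? ? _ _ [].
have [|M [[K0 K0b <-]|->] Mmin] := @min_card (W + U)%type (inl (inl 0))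
    [set M | (exists2 K0 : set W, character_bound T K0 & inW K0 = M) \/
             M = range inr].
- by exists (range inr); right.
- apply: card_le_trans (Kmin _ K0b) _.
  rewrite -(card_le_eql (inlI K0)) -(card_le_eqr inrI).
  by apply: Mmin; right.
- have UK : [set: U] #<= K.
    rewrite -(card_le_eqr (inlI K)) -(card_le_eql inrI).
    by apply: Mmin; left; exists K.
  have /card_subP[C /card_eqPle[CU UC] _] := UK.
  apply: card_le_trans CU; apply: Kmin; apply: character_bound_card TU.
  by rewrite (card_le_eqr (card_setT C)).
Qed.

(** The index set of cardinality [chi(T)].  Only its cardinality matters: it is
    determined up to bijection by [chiP]. *)
Definition chi (T : topologicalType) : choiceType :=
  set_type (projT1 (cid (character_exists T))).

Lemma chiP (T : topologicalType) : is_character T (chi T).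
Proof. exact: (projT2 (cid (character_exists T))). Qed.

(** Nets are indexed by the finite subsets of the index set [K]; the conditions
    on nets do not involve the ordering of the cardinal. *)
Definition theta_cluster (T : topologicalType) (K : choiceType) (A : set T)
    (xi : {fset K} -> T) (x : T) : Prop :=
  A x /\
  forall (U : set T) (a : K), open U -> U x ->
    exists F : {fset K}, a \in F /\ closure (U `&` A) (xi F).

Definition chi_net_closed (T : topologicalType) (A : set T) : Prop :=
  forall xi : {fset chi T} -> T, (forall F, A (xi F)) ->
    (exists x, theta_cluster [set: T] xi x) ->
    exists x, theta_cluster A xi x.

Definition chi_lindelof (T : topologicalType) : Prop :=
  forall (A : set T) (U : chi T -> set (set T)),
    chi_net_closed A ->
    (forall a O, U a O -> open O) ->
    A `<=` \bigcup_(O in \bigcup_a U a) O ->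
    exists V : chi T -> set (set T),
      (forall a, V a `<=` U a /\ countable (V a)) /\
      A `<=` \bigcup_a closure (\bigcup_(O in V a) O).

(* Main.v *)
Require Import Defs.
From mathcomp Require Import all_boot finmap.
From mathcomp Require Import boolp classical_sets functions cardinality filter.
From mathcomp Require Import topology_structure separation_axioms.

Set Implicit Arguments.
Unset Strict Implicit.
Unset Printing Implicit Defensive.

Local Open Scope classical_set_scope.
Local Open Scope card_scope.

(** In a Hausdorff space every chi-net-closed set [A] is closed.  Indeed, if [p]
    lies in the closure of [A], index a local base at [p] by [chi T] and pick
    [xi F] in the trace on [A] of the intersection of the basic neighborhoods
    indexed by [F].  This net clusters at [p], and at no other point, because
    its members indexed by sets containing [a] stay in the [a]-th basic
    neighborhood of [p]; as some cluster point lies in [A], [p] does too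
    ([chi_net_closed_closed]).

    A closed subset of a Lindelof space is Lindelof ([closed_lindelof]), so
    countably many members of the given cover suffice to cover [A].  Sorting
    them according to the subcollections from which they come gives the
    countable families required. *)

Lemma chi_local_base (T : topologicalType) (p : T) :
  exists N : chi T -> set T, (forall a, open_nbhs p (N a)) /\
    forall U, open_nbhs p U -> exists a, N a `<=` U.
Proof.
have [[_ /(_ p)[B [BN NB]]] /pcard_surjP[N NBsurj] _] := chiP T.
have [O0 BO0 _] := NB setT (conj openT I).
(* Indices sent outside the base are redirected to a fixed member of it. *)
exists (fun a => if `[< B (N a) >] then N a else O0); split.
  by move=> a; case: asboolP => [/BN|_] //; exact: BN.
move=> U /NB[O BO OU]; have [a _ NaO] := NBsurj O BO.
by exists a; rewrite NaO asboolT.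
Qed.

(** A net in [A] that converges to a closure point [p] has [p] as its only
    theta-cluster point: a neighborhood [V] of [p] that misses an open [U] also
    misses the closure of [U `&` A], so the members of the net in [V] cannot
    witness clustering at a point of [U]. *)
Lemma chi_net_closed_closed (T : topologicalType) (A : set T) :
  hausdorff_space T -> chi_net_closed A -> closed A.
Proof.
move=> hT cA p clAp; have [N [Np Nbase]] := chi_local_base p.
have /choice[xi xiP] : forall F : {fset chi T}, exists x,
    A x /\ forall a, a \in F -> N a x.
  move=> F; have [|x [Ax Nx]] := clAp (\bigcap_(a in [set` F]) N a).
    by apply: filter_bigI => a _; exact: open_nbhs_nbhs.
  by exists x; split=> // a aF; exact: Nx.
have [F||q [Aq xiq]] := cA xi; first exact: (xiP F).1.
  exists p; split=> // U a oU Up; have [b NbU] := Nbase U (conj oU Up).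
  (* [a] because clustering asks for it, [b] to bring the point into [U]. *)
  exists [fset a; b]%fset; split; first by rewrite !inE eqxx.
  by rewrite setIT; apply: subset_closure; apply/NbU/(xiP _).2; rewrite !inE eqxx orbT.
have [<-//|pq] := eqVneq q p.
move: hT; rewrite open_hausdorff => /(_ _ _ pq)[[U V] /= [/set_mem Uq /set_mem Vp]].
move=> [oU oV /eqP UV0]; have [a NaV] := Nbase V (conj oV Vp).
(* An index containing [a] puts [xi F] in [V] and in the closure of [U `&` A]. *)
have [F [aF]] := xiq U a oU Uq.
move=> /(_ V); have Vxi : V (xi F) by apply/NaV/(xiP F).2.
move=> /(_ (open_nbhs_nbhs (conj oV Vxi)))[z [[Uz _] Vz]].
by have : (U `&` V) z by []; rewrite UV0.
Qed.

(** Adding the complement of [A] to the family turns it into a cover of the whole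
    space. *)
Lemma closed_lindelof (T : topologicalType) (A : set T) (W : set (set T)) :
  lindelof T -> closed A -> (forall O, W O -> open O) ->
  A `<=` \bigcup_(O in W) O ->
  exists V, [/\ V `<=` W, countable V & A `<=` \bigcup_(O in V) O].
Proof.
move=> lT cA oW AW.
have [O|x _|V [VW cV TV]] := lT (~` A |` W).
- by move=> [->|/oW//]; exact: closed_openC.
- have [/AW[O WO Ox]|nAx] := pselect (A x); first by exists O => //; right.
  by exists (~` A) => //; left.
exists (V `&` W); split; first by move=> O [].
  by apply: sub_countable cV; apply: subset_card_le => O [].
move=> x Ax; have [O VO Ox] := TV x I; exists O => //; split=> //.
by have [OA|//] := VW O VO; move: Ox; rewrite OA.
Qed.

Theorem proposition8 (T : topologicalType) (hT : hausdorff_space T)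
    (lT : lindelof T) : chi_lindelof T.
Proof.
move=> A U /(chi_net_closed_closed hT) cA oU AU.
have [O [a _ /oU//]|V [VU cV AV]] := closed_lindelof lT cA _ AU.
exists (fun a => V `&` U a); split=> [a|x /AV[O VO Ox]].
  split; first by move=> O [].
  by apply: sub_countable cV; apply: subset_card_le => O [].
have [a _ UaO] := VU O VO.
by exists a => //; apply: subset_closure; exists O.
Qed.
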